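(* Let $\alpha,\beta$ be any constants and, for $j=1,2,\ldots$, let $\Phi_j(r)=\alpha\sin(jr)+\beta\cos(jr)$. Then, for every $j=1,2,\ldots$, $$u(x)=\big(-\partial_2\Phi_j(r),\partial_1\Phi_j(r),0\big)$$ is a solution of the static two-dimensional Euler equations $$(u\cdot\nabla)u+\nabla P=0,\qquad \nabla\cdot u=0,$$ with symplectic representation $u(x)=\big(-\partial_2\phi(x),\partial_1\phi(x),0\big)$ and periodic boundary condition $$\phi(r+2\pi)=\phi(r),\qquad\forall r\ge0.$$
   Context: Here $x=(x_1,x_2)\in\mathbb{R}^2$, $r=|x|$, $\partial_j=\partial_{x_j}$, $u$ is the velocity field (depending only on $x_1,x_2$, with zero third component), and $P$ is the scalar pressure (an unknown of the equations). The function $\phi$ in the symplectic representation is radial, here $\phi=\Phi_j$.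
   Formalization: When α ≠ 0 the function Φ_j(|x|) has no partial derivatives at the origin, so u(0) is undefined; the equations and the symplectic representation are asserted on ℝ² without the origin if α ≠ 0, and on all of ℝ² if α = 0. *)

(* Defs.v *)
From HB Require Import structures.
From mathcomp Require Import all_boot all_order all_algebra.
From mathcomp Require Import all_classical all_reals all_analysis.

Set Implicit Arguments.
Unset Strict Implicit.
Unset Printing Implicit Defensive.

Import Order.TTheory GRing.Theory Num.Theory.
Import numFieldNormedType.Exports.

Local Open Scope classical_set_scope.
Local Open Scope ring_scope.

(* The norm that the library puts on 'rV[R]_2 is the sup norm, so the
   Euclidean r = |x| is written out. *)
Definition euclid_norm (R : realType) (x : 'rV[R]_2) : R :=
  Num.sqrt (x 0 0 ^+ 2 + x 0 1 ^+ 2).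

(* d1 f x and d2 f x are the partial derivatives of f in x_1 and x_2, the
   coordinates of index 0 and 1.  'D_v f x is a limit, with an arbitrary value
   when the limit does not exist. *)
Definition d1 (R : realType) (V : normedModType R) (f : 'rV[R]_2 -> V)
    (x : 'rV[R]_2) : V := 'D_(delta_mx 0 0) f x.

Definition d2 (R : realType) (V : normedModType R) (f : 'rV[R]_2 -> V)
    (x : 'rV[R]_2) : V := 'D_(delta_mx 0 1) f x.

(* Velocity fields have three components but depend on x_1 and x_2 only, so
   the terms in the third partial derivative vanish in the operators below. *)

Definition convective (R : realType) (u : 'rV[R]_2 -> 'rV[R]_3)
    (x : 'rV[R]_2) : 'rV[R]_3 :=
  u x 0 0 *: d1 u x + u x 0 1 *: d2 u x.

Definition divergence (R : realType) (u : 'rV[R]_2 -> 'rV[R]_3)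
    (x : 'rV[R]_2) : R :=
  d1 (fun y => u y 0 0) x + d2 (fun y => u y 0 1) x.

Definition gradient (R : realType) (P : 'rV[R]_2 -> R)
    (x : 'rV[R]_2) : 'rV[R]_3 :=
  \row_(i < 3) [:: d1 P x; d2 P x; 0]`_i.

Definition static_euler_solution (R : realType) (Omega : set 'rV[R]_2)
    (u : 'rV[R]_2 -> 'rV[R]_3) : Prop :=
  exists P : 'rV[R]_2 -> R, forall x, Omega x ->
    [/\ differentiable u x, differentiable P x,
        convective u x + gradient P x = 0 & divergence u x = 0].

Definition symplectic_field (R : realType) (phi : 'rV[R]_2 -> R)
    (x : 'rV[R]_2) : 'rV[R]_3 :=
  \row_(i < 3) [:: - d2 phi x; d1 phi x; 0]`_i.

Definition symplectic_representation (R : realType) (Omega : set 'rV[R]_2)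
    (u : 'rV[R]_2 -> 'rV[R]_3) (phi : 'rV[R]_2 -> R) : Prop :=
  forall x, Omega x -> differentiable phi x /\ u x = symplectic_field phi x.

Definition Phi (R : realType) (alpha beta : R) (j : nat) (r : R) : R :=
  alpha * sin (j%:R * r) + beta * cos (j%:R * r).

(* Near the origin Phi alpha beta j (euclid_norm x) = beta + alpha * j * |x| +
   O(|x|^2).  For alpha != 0 and 0 < j this has no partial derivatives at the
   origin, and the velocity is not defined there; for alpha = 0 it is a smooth
   function on the whole plane. *)
Definition velocity_domain (R : realType) (alpha : R) : set 'rV[R]_2 :=
  [set x | x != 0 \/ alpha = 0].

(* Main.v *)
Require Import Defs.
From HB Require Import structures.
From mathcomp Require Import all_boot all_order all_algebra.
From mathcomp Require Import all_classical all_reals all_analysis.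
From mathcomp Require Import ring.

Import Order.TTheory GRing.Theory Num.Theory.
Import numFieldNormedType.Exports.

Local Open Scope classical_set_scope.
Local Open Scope ring_scope.

(** Put [s = |x|^2].  For [phi x = F |x|^2] and [f = F'], the velocity is
    [2 f(s) (- x_2, x_1, 0)], a rotation along circles, so
    [(u . grad) u = - 4 f(s)^2 (x_1, x_2, 0)]; this is [- grad P] for
    [P x = Q |x|^2] as soon as [Q' = 2 f^2].  When [alpha <> 0] this is applied
    on [s > 0] with [F s = Phi (sqrt s)].  When [alpha = 0] the origin is
    included: [cos (sqrt s)] is the restriction to [s >= 0] of the entire series
    [sum_n (- s)^n / (2n)!], so [F] is smooth on the whole line and the same
    argument is applied on [s > -1]. *)

(** * Antiderivatives and differentials *)

(** Since [h] may be singular at [a], the integral is based at an interior point [c] rather than at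
    [a]. *)
Lemma has_antiderivative_gt (R : realType) (a : R) (h : R -> R) :
  (forall s, a < s -> {for s, continuous h}) ->
  exists Q : R -> R, forall s, a < s -> is_derive s 1 Q (h s).
Proof.
move=> ch.
pose mu := @lebesgue_measure R; pose c := a + 1.
have ac : a < c by rewrite ltrDl.
have ih b y : a < b -> mu.-integrable `[b, y] (EFin \o h).
  move=> ab; apply: continuous_compact_integrable; first exact: segment_compact.
  apply: continuous_in_subspaceT => z; rewrite inE/= in_itv/= => /andP[bz _].
  exact/ch/(lt_le_trans ab).
(* [I x y = 0] for [y <= x], so one of the two terms of the witness below always
   vanishes and their difference is the oriented integral from [c]. *)
pose I x y := (\int[mu]_(t in `[x, y]) h t)%R.
have IB b x y : a < b -> b <= x -> x <= y -> I b y - I b x = I x y.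
  move=> ab bx xy; rewrite /I (@Rintegral_itvB R h (BLeft b) (BRight y) x)//.
    rewrite Rintegral_itv_obnd_cbnd//.
    apply: (@integrableS _ _ _ mu `[x, y]) => //; last exact/ih/(lt_le_trans ab).
    by apply: subset_itv; rewrite bnd_simp.
  exact: ih.
have I0 x y : y <= x -> I x y = 0.
  rewrite le_eqVlt => /predU1P[->|yx]; rewrite /I.
    by rewrite set_itv1 Rintegral_set1.
  by rewrite set_itv_ge ?Rintegral_set0// bnd_simp -ltNge.
exists (fun y => I c y - I y c) => s as_.
(* With [b] in [(a, min(s, c))], the witness equals near [s] the integral from the fixed endpoint
   [b] minus the constant [I b c], so the fundamental theorem of calculus applies. *)
pose b := (a + Num.min s c) / 2.
have asc : a < Num.min s c by rewrite lt_min as_ ac.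
have [ab bsc] : a < b /\ b < Num.min s c by split; rewrite midf_lt.
move: bsc; rewrite lt_min => /andP[bs bc].
apply: (@near_eq_is_derive _ _ _ (fun y => I b y - I b c)).
  near=> y; have by_ : b < y by near: y; exact: lt_nbhsr.
  have [cy|yc] := leP c y.
    by rewrite (IB b c y)// ?(ltW bc)// (I0 y c)// subr0.
  by rewrite (I0 c y) ?(ltW yc)// -(IB b y c)// ?ltW//; rewrite sub0r opprB.
have [dI I'] : derivable (fun y => I b y) s 1 /\ derive1 (fun y => I b y) s = h s.
  apply: (@continuous_FTC1_closed R h b s (s + 1)) => //.
  - by rewrite ltrDl.
  - exact: ih.
  - exact: ch.
rewrite -(subr0 (h s)); apply: is_deriveB.
by apply: DeriveDef => //; rewrite -derive1E.
Unshelve. all: by end_near. Qed.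

(** A first-order expansion involves only the germ at [x], so the expansion of [f] is also one of
    [g]. *)
Lemma near_eq_is_diff (R : numFieldType) (V W : normedModType R)
    (f g df : V -> W) (x : V) :
  {near x, f =1 g} -> is_diff x f df -> is_diff x g df.
Proof.
move=> fg [fx <-].
have gx : g \o shift x = cst (g x) + 'd f x +o_ 0 id.
  apply/eqaddoP => e e0.
  have /eqaddoP/(_ _ e0) := diff_locally fx.
  have : \forall y \near 0, f (y + x) = g (y + x).
    by move/nbhs0P: fg; apply: filterS => y; rewrite addrC.
  apply: filterS2 => y /= fgy; rewrite !fctE /= -fgy.
  by rewrite (nbhs_singleton fg).
have cf : continuous ('d f x) by exact: diff_continuous.
have dg := diff_unique cf gx.
apply: DiffDef => //.
by apply/diff_locallyP; rewrite dg.
Unshelve. all: by end_near. Qed.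

Lemma is_diff_coord (R : realFieldType) (m n : nat) (i : 'I_m) (j : 'I_n)
    (x : 'M[R]_(m, n)) :
  is_diff x (fun N : 'M[R]_(m, n) => N i j : R) (fun N => N i j).
Proof.
apply: DiffDef; first exact: differentiable_coord.
have lin : linear (fun N : 'M[R]_(m, n) => N i j : R) by move=> a u v; rewrite !mxE.
pose f : {linear 'M[R]_(m, n) -> R} :=
  HB.pack (fun N : 'M[R]_(m, n) => N i j : R) (GRing.isLinear.Build _ _ _ _ _ lin).
exact: (@diff_lin _ _ _ f x (@coord_continuous _ _ _ i j)).
Qed.

(** * Power series dominated by the exponential series *)

(** The bound survives formal differentiation because [(n+1) / (n+1)! = 1 / n!], so it can be
    iterated. *)
Lemma norm_pseries_diffs_le (R : realType) (c : R^nat) :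
  (forall n, `|c n| <= n`!%:R^-1) ->
  forall n, `|pseries_diffs c n| <= n`!%:R^-1.
Proof.
move=> hc n; rewrite /pseries_diffs normrM ger0_norm//.
apply: (le_trans (ler_wpM2l (ler0n _ _) (hc n.+1))).
by rewrite factS natrM invfM mulVKf.
Qed.

Lemma is_derive_pseries (R : realType) (c : R^nat) (x : R) :
  (forall n, `|c n| <= n`!%:R^-1) ->
  is_derive x 1 (fun x => limn (pseries c x))
    (limn (pseries (pseries_diffs c) x)).
Proof.
move=> hc.
have cvgd (d : R^nat) K : (forall n, `|d n| <= n`!%:R^-1) -> cvgn (pseries d K).
  move=> hd; apply: normed_cvg.
  apply: series_le_cvg (is_cvg_series_exp_coeff `|K|) => n //=.
    by rewrite divr_ge0.
  by rewrite normrM normrX mulrC ler_wpM2l.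
(* Termwise differentiation at [x] asks for convergence of the series and of its first two formal
   derivatives at one point of larger modulus. *)
apply: (@pseries_snd_diffs _ _ (`|x| + 1)).
- exact: cvgd.
- exact/cvgd/norm_pseries_diffs_le.
- exact/cvgd/norm_pseries_diffs_le/norm_pseries_diffs_le.
- by rewrite [ltRHS]ger0_norm ?addr_ge0// ltrDl.
Qed.

(** * Radial stream functions and the Euler equations *)

(** Unlike [|x|], this variable is polynomial in [x], hence smooth at the origin too. *)
Definition sqnorm (R : realType) (x : 'rV[R]_2) : R := x 0 0 ^+ 2 + x 0 1 ^+ 2.

Lemma is_diff_radial (R : realType) (F : R -> R) (f : R) (x : 'rV[R]_2) :
  is_derive (sqnorm R x) 1 F f ->
  is_diff x (fun y => F (sqnorm R y))
    (fun v => f * (2 * (x 0 0 * v 0 0 + x 0 1 * v 0 1))).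
Proof.
move=> [dF F'].
have dFx : is_diff (sqnorm R x) F (fun h => h *: f).
  have dfF : differentiable F (sqnorm R x) by exact/derivable1_diffP.
  by apply: DiffDef => //; rewrite diff1E// derive1E F'.
have dx0 := is_diff_coord R 1 2 0 0 x.
have dx1 := is_diff_coord R 1 2 0 1 x.
have dn : is_diff x (sqnorm R) (fun v => 2 * (x 0 0 * v 0 0 + x 0 1 * v 0 1)).
  apply: is_diff_eq; apply/funext => v.
  rewrite !fctE /GRing.scale/=; ring.
by apply: is_diff_eq; apply/funext => v /=; rewrite /GRing.scale/= mulrC.
Qed.

Lemma near_sqnorm_gt (R : realType) (a : R) (x : 'rV[R]_2) :
  a < sqnorm R x -> \forall y \near x, a < sqnorm R y.
Proof.
have [dn _] := is_diff_radial R id 1 x (is_derive_id _ _).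
by move=> ax; exact: (differentiable_continuous dn) (lt_nbhsr ax).
Qed.

Lemma symplectic_radial_euler (R : realType) (a : R) (F f f' Q : R -> R) :
  (forall s, a < s -> is_derive s 1 F (f s)) ->
  (forall s, a < s -> is_derive s 1 f (f' s)) ->
  (forall s, a < s -> is_derive s 1 Q (2 * f s ^+ 2)) ->
  let Omega := [set x | a < sqnorm R x] in
  let phi := fun x => F (sqnorm R x) in
  static_euler_solution Omega (symplectic_field phi) /\
  symplectic_representation Omega (symplectic_field phi) phi.
Proof.
move=> dF df dQ Omega phi.
have dphi x : Omega x -> is_diff x phi
    (fun v => f (sqnorm R x) * (2 * (x 0 0 * v 0 0 + x 0 1 * v 0 1))).
  by move=> ax; apply/is_diff_radial/dF.
split; last by move=> x /dphi[].
pose e (i : 'I_2) : 'rV[R]_2 := delta_mx 0 i.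
have eE (i j : 'I_2) : e i 0 j = (j == i)%:R by rewrite mxE eqxx.
pose u1 (y : 'rV[R]_2) := - (2 * f (sqnorm R y)) * y 0 1.
pose u2 (y : 'rV[R]_2) := 2 * f (sqnorm R y) * y 0 0.
pose w (i : 'I_3) : 'rV[R]_3 := delta_mx 0 i.
(* [U] is the explicit rotation field. It is known to agree with [symplectic_field phi] only on
   [Omega]; as [Omega] is open, they agree near each of its points, which suffices to
   differentiate. *)
pose U (y : 'rV[R]_2) := u1 y *: w 0 + u2 y *: w 1.
have uU x : Omega x -> symplectic_field phi x = U x.
  move=> ax; have dx := dphi _ ax.
  rewrite /symplectic_field /d1 /d2 !deriveE// diff_val -/(e 0) -/(e 1) !eE/=.
  apply/rowP => k; rewrite !mxE eqxx/= /u1 /u2.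
  case: k => -[|[|[|//]]] ? /=; ring.
exists (fun x => Q (sqnorm R x)) => x ax.
have nU : {near x, U =1 symplectic_field phi}.
  by have := near_sqnorm_gt R a x ax; apply: filterS => y ay; rewrite uU.
pose s := sqnorm R x.
pose L (v : 'rV[R]_2) := f' s * (2 * (x 0 0 * v 0 0 + x 0 1 * v 0 1)).
have df_ := is_diff_radial R f (f' s) x (df _ ax).
have dx0 := is_diff_coord R 1 2 0 0 x.
have dx1 := is_diff_coord R 1 2 0 1 x.
pose du1 (v : 'rV[R]_2) := - (2 * (L v * x 0 1 + f s * v 0 1)).
pose du2 (v : 'rV[R]_2) := 2 * (L v * x 0 0 + f s * v 0 0).
have d_u1 : is_diff x u1 du1.
  rewrite (_ : u1 = - (2 *: ((fun y => f (sqnorm R y)) * (fun y => y 0 1)))).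
    apply: is_diff_eq; apply/funext => v; rewrite /du1 !fctE /GRing.scale/= /L; ring.
  by apply/funext => y; rewrite !fctE /u1 /GRing.scale/=; ring.
have d_u2 : is_diff x u2 du2.
  rewrite (_ : u2 = 2 *: ((fun y => f (sqnorm R y)) * (fun y => y 0 0))).
    apply: is_diff_eq; apply/funext => v; rewrite /du2 !fctE /GRing.scale/= /L; ring.
  by apply/funext => y; rewrite !fctE /u2 /GRing.scale/=; ring.
have du : is_diff x (symplectic_field phi) (fun v => du1 v *: w 0 + du2 v *: w 1).
  apply: near_eq_is_diff nU _; rewrite /U.
  have h1 : is_diff x (fun y => u1 y *: w 0) (fun v => du1 v *: w 0).
    by apply: DiffDef; [exact: differentiableZl|rewrite diffZl// diff_val].
  have h2 : is_diff x (fun y => u2 y *: w 1) (fun v => du2 v *: w 1).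
    by apply: DiffDef; [exact: differentiableZl|rewrite diffZl// diff_val].
  exact: is_diffD.
have dP := is_diff_radial R Q (2 * f s ^+ 2) x (dQ _ ax).
split; [by case: du|by case: dP| |].
(* The terms in [f'] cancel here and in the divergence: [u] is tangent to the circles on which
   [f(|x|^2)] is constant. What remains is [- 4 f^2 x] against the gradient [2 f^2 * 2 x]. *)
- rewrite /convective /gradient /d1 /d2 !deriveE// !diff_val -/(e 0) -/(e 1) uU//.
  apply/rowP => k; rewrite /U !mxE !eqxx/= /u1 /u2 /du1 /du2 /L !eE -/s.
  case: k => -[|[|[|//]]] ? /=; ring.
- have duk (k : 'I_3) : is_diff x (fun y => symplectic_field phi y 0 k)
      (fun v => (du1 v *: w 0 + du2 v *: w 1) 0 k).
    exact: (@is_diff_comp _ _ _ _ _ _ (fun N : 'rV[R]_3 => N 0 k) _ x du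
      (is_diff_coord R 1 3 0 k (symplectic_field phi x))).
  rewrite /divergence /d1 /d2 !deriveE// !diff_val -/(e 0) -/(e 1).
  rewrite !mxE !eqxx/= /du1 /du2 /L !eE /=; ring.
Qed.

(** Derivability of [f] makes [2 f^2] continuous, so the pressure profile [Q] exists. *)
Lemma symplectic_radial_euler_C2 (R : realType) (a : R) (F f : R -> R) :
  (forall s, a < s -> is_derive s 1 F (f s)) ->
  (forall s, a < s -> derivable f s 1) ->
  let Omega := [set x | a < sqnorm R x] in
  let phi := fun x => F (sqnorm R x) in
  static_euler_solution Omega (symplectic_field phi) /\
  symplectic_representation Omega (symplectic_field phi) phi.
Proof.
move=> dF df.
have [|Q dQ] := has_antiderivative_gt R a (fun s => 2 * f s ^+ 2).
  move=> s /df fs; apply/differentiable_continuous/derivable1_diffP.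
  exact: (@derivableZ _ _ _ (f ^+ 2) 2 s 1 (derivableX fs)).
apply: (symplectic_radial_euler R a F f ('D_1 f) Q) => // s /df.
exact: derivableP.
Qed.

Lemma velocity_domain_sqnorm_gt0 (R : realType) (alpha : R) (x : 'rV[R]_2) :
  alpha != 0 -> velocity_domain alpha x -> 0 < sqnorm R x.
Proof.
move=> /eqP a0 [x0|//]; rewrite lt_neqAle addr_ge0 ?sqr_ge0// andbT eq_sym.
apply: contraNneq x0; rewrite /sqnorm => /eqP.
rewrite paddr_eq0 ?sqr_ge0// !sqrf_eq0 => /andP[/eqP x0 /eqP x1].
apply/eqP/rowP => -[[|[|//]] i]; rewrite mxE; [rewrite -[RHS]x0|rewrite -[RHS]x1];
  congr (x _ _); exact: val_inj.
Qed.

(** * The cosine as a power series in the square of its argument *)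

(** Coefficients of the entire function equal to [cos (sqrt t)] for [t >= 0] and to
    [cosh (sqrt (- t))] for [t < 0]. *)
Definition cos_sqrt_coeff (R : realType) (n : nat) : R := (-1) ^+ n / n.*2`!%:R.

Lemma norm_cos_sqrt_coeff_le (R : realType) (n : nat) :
  `|cos_sqrt_coeff R n| <= n`!%:R^-1.
Proof.
rewrite normrM normrX normrN1 expr1n mul1r ger0_norm ?invr_ge0//.
rewrite lef_pV2 ?posrE ?ltr0n ?fact_gt0// ler_nat.
case: n => [//|n]; apply/ltnW/ltn_fact => //.
by rewrite -addnn addSn ltnS leq_addl.
Qed.

Lemma cos_pseries_sqr (R : realType) (y : R) :
  cos y = limn (pseries (cos_sqrt_coeff R) (y ^+ 2)).
Proof.
rewrite -(cvg_lim (@Rhausdorff R) (@cvg_cos_coeff' R y)).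
congr (lim (series _ @ \oo)); apply/funext => n.
by rewrite /cos_coeff' /cos_sqrt_coeff /= -exprM mul2n -exprnP mulrAC.
Qed.

(** * The functions [Phi]: periodicity, and the cases with and without the origin *)

Lemma Phi_periodic (R : realType) (alpha beta : R) (j : nat) :
  periodic (Phi alpha beta j) (2 * pi).
Proof.
move=> r; rewrite /Phi mulrDr.
(* As [j] is an integer, the argument increases by [j] whole periods. *)
have -> : j%:R * (2 * pi) = (pi *+ 2) *+ j :> R by rewrite !mulr_natl.
by rewrite (periodicn (@sinD2pi R)) (periodicn (@cosD2pi R)).
Qed.

Lemma Phi0_euler (R : realType) (beta : R) (j : nat) :
  let phi x := Phi 0 beta j (euclid_norm x) in
  static_euler_solution [set: 'rV[R]_2] (symplectic_field phi) /\
  symplectic_representation [set: 'rV[R]_2] (symplectic_field phi) phi.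
Proof.
move=> phi.
pose c := cos_sqrt_coeff R.
(* The factor [j^2] comes from [cos (j |x|)] being the series in [(j |x|)^2 = j^2 |x|^2]. *)
pose C (d : R^nat) (s : R) : R := limn (pseries d (j%:R ^+ 2 * s)).
have dC (d : R^nat) (s : R) : (forall n, `|d n| <= n`!%:R^-1) ->
    is_derive s 1 (C d) (C (pseries_diffs d) s * j%:R ^+ 2).
  move=> hd.
  have dl : is_derive s 1 (fun s => j%:R ^+ 2 * s) (j%:R ^+ 2 : R).
    by apply: is_derive_eq (is_deriveZ _ (is_derive_id s 1)) _; exact: mulr1.
  exact: is_derive1_comp (is_derive_pseries R d _ hd) dl.
have hc : forall n, `|c n| <= n`!%:R^-1 by exact: norm_cos_sqrt_coeff_le.
have phiE : phi = fun x => beta * C c (sqnorm R x).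
  apply/funext => x; rewrite /phi /Phi mul0r add0r cos_pseries_sqr exprMn.
  by rewrite sqr_sqrtr// addr_ge0// sqr_ge0.
(* A negative threshold such as [- 1] puts [s = 0] inside the half-line, so [Omega] is the whole
   plane. *)
have [||E S] := symplectic_radial_euler_C2 R (- 1) (fun s => beta * C c s)
    (fun s => beta * (C (pseries_diffs c) s * j%:R ^+ 2)).
- by move=> s _; exact: (is_deriveZ beta (dC c s hc)).
- move=> s _; have [dc _] := dC _ s (norm_pseries_diffs_le R c hc).
  by apply: derivableZ; apply: derivableM => //; exact: derivable_cst.
have all1 : [set x | - 1 < sqnorm R x] = [set: 'rV[R]_2].
  apply/seteqP; split => // x _ /=.
  by rewrite (lt_le_trans (ltrN10 R))// addr_ge0// sqr_ge0.
by rewrite phiE -all1.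
Qed.

Lemma Phi_euler (R : realType) (alpha beta : R) (j : nat) :
  let Omega := [set x : 'rV[R]_2 | 0 < sqnorm R x] in
  let phi x := Phi alpha beta j (euclid_norm x) in
  static_euler_solution Omega (symplectic_field phi) /\
  symplectic_representation Omega (symplectic_field phi) phi.
Proof.
pose l (s : R) : R := j%:R * Num.sqrt s.
pose l' (s : R) : R := j%:R * (2 * Num.sqrt s)^-1.
(* The derivative of [Phi (sqrt s)], by the chain rule with inner function [l]. *)
pose f (s : R) := (alpha * cos (l s) - beta * sin (l s)) * l' s.
have dl (s : R) : 0 < s -> is_derive s 1 l (l' s).
  by move=> s0; have ds := is_derive1_sqrt s0; exact: is_deriveZ.
have dsin (s : R) (s0 : 0 < s) : is_derive s 1 (fun s => sin (l s)) (cos (l s) * l' s).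
  exact: is_derive1_comp (is_derive_sin (l s)) (dl s s0).
have dcos (s : R) (s0 : 0 < s) : is_derive s 1 (fun s => cos (l s)) (- sin (l s) * l' s).
  exact: is_derive1_comp (is_derive_cos (l s)) (dl s s0).
apply: (symplectic_radial_euler_C2 R 0 (fun s => Phi alpha beta j (Num.sqrt s)) f).
  move=> s s0.
  have dPhi := is_deriveD (is_deriveZ alpha (dsin s s0)) (is_deriveZ beta (dcos s s0)).
  by apply: (is_derive_eq dPhi); rewrite /f /GRing.scale/=; ring.
move=> s s0.
have dl' : derivable l' s 1.
  have [ds _] := is_derive1_sqrt s0.
  apply: derivableZ; apply: derivableV; last exact: derivableZ.
  by rewrite mulf_neq0// gt_eqF// sqrtr_gt0.
have [dPhi' _] := is_deriveB (is_deriveZ alpha (dcos s s0)) (is_deriveZ beta (dsin s s0)).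
exact: (derivableM dPhi' dl').
Qed.

Theorem mainTheorem9 (R : realType) (alpha beta : R) (j : nat)
    (hj : (0 < j)%N) :
  let phi : 'rV[R]_2 -> R := fun x => Phi alpha beta j (euclid_norm x) in
  let u : 'rV[R]_2 -> 'rV[R]_3 := fun x =>
    \row_(i < 3) [:: - d2 phi x; d1 phi x; 0]`_i in
  [/\ static_euler_solution (velocity_domain alpha) u,
      symplectic_representation (velocity_domain alpha) u phi &
      forall r : R, 0 <= r ->
        Phi alpha beta j (r + 2 * pi) = Phi alpha beta j r].
Proof.
move=> phi u.
have [E S] : static_euler_solution (velocity_domain alpha) u /\
    symplectic_representation (velocity_domain alpha) u phi.
  (* For [alpha = 0] the solution on the whole plane is restricted; otherwise the domain excludes
     the origin, which means [|x|^2 > 0]. *)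
  have [a0|a0] := eqVneq alpha 0.
    have [[P hP] S] := Phi0_euler R beta j.
    by rewrite /u /phi a0; split; [exists P => x _; exact: hP|move=> x _; exact: S].
  have [[P hP] S] := Phi_euler R alpha beta j.
  split; first exists P; move=> x /(velocity_domain_sqnorm_gt0 R alpha x a0).
    exact: hP.
  exact: S.
by split=> // r _; exact: Phi_periodic.
Qed.
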